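(* Assume that $X[\mathcal{T}]$ is a locally convex topological vector space; $|||\cdot|||$ is a seminorm on $X$ that is $\mathcal{T}$-lower-semicontinuous; $\langle X_k\rangle_{k\in\mathbb{N}}$ is a non-decreasing sequence of $\mathcal{T}$-closed vector subspaces whose union is $X$; $C_k=X_k\cap\{x:|||x|||\le k\}$ for each $k\in\mathbb{N}$; $\mathcal{T}|_{C_k}$ is first countable for each $k\in\mathbb{N}$; and $\mathcal{C}=\{C_k:k\in\mathbb{N}\}$. For fixed $k\in\mathbb{N}$ write $\mathcal{T}^k=\mathcal{T}|_{X_k}$ and $\mathcal{T}^k_{\mathrm{loc}}=(\mathcal{T}|_{X_k})_{\mathcal{C}|_{X_k}}$, the localization of $\mathcal{T}|_{X_k}$ by the localizing family $\mathcal{C}|_{X_k}=\{C\cap X_k:C\in\mathcal{C}\}$ in $X_k$, and consider the following propositions. (1) $X_k[\mathcal{T}^k]$ is barrelled. (2) $X_k[\mathcal{T}^k_{\mathrm{loc}}]$ is barrelled. (3) The restriction of $|||\cdot|||$ to $X_k$ is $\mathcal{T}^k$-continuous. (4) The restriction of $|||\cdot|||$ to $X_k$ is sequentially $\mathcal{T}^k$-continuous. (5) The restriction of $|||\cdot|||$ to $X_k$ is sequentially $\mathcal{T}^k_{\mathrm{loc}}$-continuous. (6) The restriction of $|||\cdot|||$ to $X_k$ is $\mathcal{T}^k_{\mathrm{loc}}$-continuous. (7) $X_k[\mathcal{T}^k_{\mathrm{loc}}]$ is Fréchet–Urysohn. (8) $X_k[\mathcal{T}^k_{\mathrm{loc}}]$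 is bornological. (9) $(\mathcal{T}^k)_{\mathrm{seq}}=\mathcal{T}^k_{\mathrm{loc}}$. (10) $\mathcal{T}^k=\mathcal{T}^k_{\mathrm{loc}}$. For every $k\in\mathbb{N}$ the following hold. (A) $(4)\iff(5)\iff(6)\iff(7)\iff(8)$. (B) $[(1)\vee(2)\vee(3)]\Rightarrow[(4)\wedge(5)\wedge(6)\wedge(7)\wedge(8)]$. (C) $(3)\Rightarrow(10)$. (D) If $\mathcal{T}_{\mathcal{C}}$ is sequential then $[(4)\vee(5)\vee(6)\vee(7)\vee(8)]\Rightarrow(9)$. (E) If both $\mathcal{T}$ and $\mathcal{T}_{\mathcal{C}}$ are sequential then: (a) $(3)\iff(4)\iff(5)\iff(6)\iff(7)\iff(8)$; (b) $(1)\iff(2)$; (c) $[(1)\vee(2)]\Rightarrow[(3)\wedge(4)\wedge(5)\wedge(6)\wedge(7)\wedge(8)]$; (d) $[(3)\vee(4)\vee(5)\vee(6)\vee(7)\vee(8)]\Rightarrow(10)$.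
   Context: All vector spaces are real; topological vector spaces are Hausdorff. $X[\mathcal{T}]$ denotes $X$ equipped with the topology $\mathcal{T}$; for a collection $\mathcal{T}$ of subsets of $X$ and $C\subseteq X$, $\mathcal{T}|_C=\{E\cap C:E\in\mathcal{T}\}$. A localizing family in a vector space $X$ is a non-empty collection $\mathcal{C}$ of convex subsets of $X$ containing $0$ such that for all $C\in\mathcal{C}$, $x\in X$, $t\in\mathbb{R}$ there is $D\in\mathcal{C}$ with $x+t\cdot C\subseteq D$. Given a locally convex topology $\mathcal{T}$ on $X$ and a localizing family $\mathcal{C}$ in $X$, the localization $\mathcal{T}_{\mathcal{C}}$ is the locally convex vector topology on $X$ consisting of all $E\subseteq X$ such that for every $x\in E$ there is a convex $V$ with $x\in V\subseteq E$ and $V\cap C\in\mathcal{T}|_C$ for every $C\in\mathcal{C}$. The families $\mathcal{C}$ and $\mathcal{C}|_{X_k}$ of the claim are localizing families in $X$ and $X_k$, respectively. A subset $A$ of a Hausdorff space is sequentially open if every sequence converging to a point of $A$ is eventually in $A$. $\mathcal{S}_{\mathrm{seq}}$ is the topology consisting of all sequentially $\mathcal{S}$-open sets. A topology $\mathcal{S}$ is sequential if $\mathcal{S}=\mathcal{S}_{\mathrm{seq}}$. A Hausdorff space is Fréchet–Urysohn if for every subset $A$ and every $x$ in the closure of $A$ there is a sequence in $A$ converging to $x$. A locally convex space is barrelled if each absolutely convex, closed, absorbing set is a neighbourhood of $0$; it is bornological if each convex balanced set absorbing every bounded set is a neighbourhood of $0$. *)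

(* Defs.v *)
From HB Require Import structures.
From mathcomp Require Import all_boot all_order all_algebra.
From mathcomp Require Import all_classical all_reals topology.
From mathcomp Require Import normedtype convex sequences.

Set Implicit Arguments.
Unset Strict Implicit.
Unset Printing Implicit Defensive.

Import Order.TTheory GRing.Theory Num.Theory.
Import numFieldNormedType.Exports.

Local Open Scope classical_set_scope.
Local Open Scope ring_scope.

(* [opens], [seq_topology] and [sequential_continuous] take the topological
   space explicitly, since different topologies on one carrier are compared. *)
Definition opens (T : topologicalType) : set (set T) := @open T.
Arguments opens : clear implicits.

Definition sequentially_open {T : topologicalType} (A : set T) :=
  forall (u : nat -> T) (x : T), A x -> u @ \oo --> x ->
    \forall n \near \oo, A (u n).

Definition seq_topology (T : topologicalType) : set (set T) :=
  [set A | sequentially_open A].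
Arguments seq_topology : clear implicits.

Definition sequential_space (T : topologicalType) := opens T = seq_topology T.

Definition sequential_continuous (T U : topologicalType) (f : T -> U) :=
  forall (u : nat -> T) (x : T), u @ \oo --> x -> f (u n) @[n --> \oo] --> f x.
Arguments sequential_continuous : clear implicits.

Definition first_countable (T : topologicalType) := forall x : T,
  exists2 B : set (set T), countable B &
    B `<=` nbhs x /\ forall U, nbhs x U -> exists2 V, B V & V `<=` U.

Definition frechet_urysohn (T : topologicalType) :=
  forall (A : set T) (x : T), closure A x ->
    exists2 u : nat -> T, (forall n, A (u n)) & u @ \oo --> x.

Definition seminorm {R : realType} {X : lmodType R} (p : X -> R) :=
  (forall x y, p (x + y) <= p x + p y) /\
  (forall (a : R) x, p (a *: x) = `|a| * p x).

Section locally_convex_notions.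
Context {R : realType}.

Definition balanced {X : lmodType R} (A : set X) :=
  forall (a : R) x, `|a| <= 1 -> A x -> A (a *: x).

Definition absorbs {X : lmodType R} (A B : set X) :=
  exists2 r : R, 0 < r & forall t : R, r <= `|t| -> B `<=` [set t *: x | x in A].

Definition absorbing {X : lmodType R} (A : set X) :=
  forall x : X, absorbs A [set x].

Definition vbounded {X : preTopologicalLmodType R} (B : set X) :=
  forall U : set X, nbhs (0 : X) U -> absorbs U B.

Definition barrelled (X : preTopologicalLmodType R) := forall A : set X,
  convex_set A -> balanced A -> closed A -> absorbing A -> nbhs (0 : X) A.

Definition bornological (X : preTopologicalLmodType R) := forall A : set X,
  convex_set A -> balanced A -> (forall B : set X, vbounded B -> absorbs A B) ->
  nbhs (0 : X) A.

End locally_convex_notions.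

Section linear_subspace.
Context {R : realType} {X : preTopologicalLmodType R}.

(* The linear subspace [W] as a vector space, with the topology induced by [X]. *)
Definition linsub (W : submodClosed X) : Type := {x : X | x \in W}.

Variable W : submodClosed X.

HB.instance Definition _ := SubChoice.on (linsub W).
HB.instance Definition _ := [SubChoice_isSubLmodule of linsub W by <:].
HB.instance Definition _ :=
  Topological.copy (linsub W) (initial_topology (\val : linsub W -> X)).

Definition restrict_family (C : set (set X)) : set (set (linsub W)) :=
  [set (\val : linsub W -> X) @^-1` D | D in C].

End linear_subspace.
Arguments restrict_family {R X} W C.

(* [localization C] is [X] with the localized topology. The conditions below
   define a topology for an arbitrary family [C]; that [C] is localizing only
   matters for the compatibility with the vector space structure. *)
Definition localization {R : realType} {X : preTopologicalLmodType R}
  (C : set (set X)) : Type := X.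

Section localization.
Context {R : realType} {X : preTopologicalLmodType R} (C : set (set X)).

Definition loc_open (E : set X) := forall x, E x -> exists V : set X,
  [/\ convex_set V, V x, V `<=` E &
      forall D, C D -> exists2 O : set X, open O & V `&` D = O `&` D].

Lemma loc_openT : loc_open setT.
Proof.
move=> x _; exists setT; split=> // D _.
by exists setT => //; exact: openT.
Qed.

Lemma loc_openI : setI_closed loc_open.
Proof.
move=> E F oE oF x [/oE[V [cV Vx VE oV]] /oF[W [cW Wx WF oW]]].
exists (V `&` W); split=> //.
- move=> a b l; rewrite !inE => -[Va Wa] [Vb Wb].
  split; apply/set_mem; [apply: cV|apply: cW]; exact/mem_set.
- exact: setISS.
- move=> D CD; have [O oO OD] := oV D CD; have [P oP PD] := oW D CD.
  exists (O `&` P); first exact: openI.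
  by rewrite setIIl OD PD -setIIl.
Qed.

Lemma loc_open_bigU (I : Type) (f : I -> set X) :
  (forall i, loc_open (f i)) -> loc_open (\bigcup_i f i).
Proof.
move=> of_ x [i _ /of_[V [cV Vx Vf oV]]]; exists V; split=> //.
by move=> y /Vf fy; exists i.
Qed.

HB.instance Definition _ := GRing.Lmodule.on (localization C).
HB.instance Definition _ := isOpenTopological.Build (localization C)
  loc_openT loc_openI loc_open_bigU.

End localization.

(* Main.v *)
(* On X_k the localization T_loc is governed by the balls {p <= r}: T and T_loc
   agree on each ball, T_loc-bounded sets are p-bounded (otherwise separate
   points z_n with p(z_n) > n from {p <= n} by open convex sets V_n, whose
   intersection is a T_loc-neighbourhood of 0), and hence a sequence converges
   for T_loc iff it converges for T and is p-bounded. First countability of the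
   balls turns sequential continuity of p into T_loc-continuity, after which
   T_loc-neighbourhoods may be cut down to balls; this gives the Frechet-Urysohn
   property and bornologicity. Conversely, bornologicity applies to {p <= e},
   and if T_loc is Frechet-Urysohn but p(y_n) >= e for some y_n -> 0, then a
   sequence drawn from the points w / m + m y_n that converges to 0 would have m
   bounded, whereas each row m converges to w / m, which is not 0. *)
Require Import Defs.
From HB Require Import structures.
From mathcomp Require Import all_boot all_order all_algebra.
From mathcomp Require Import all_classical all_reals topology.
From mathcomp Require Import normedtype convex sequences.
From mathcomp Require Import interval_inference.
From mathcomp Require Import lra zify.

Set Implicit Arguments.
Unset Strict Implicit.
Unset Printing Implicit Defensive.

Import Order.TTheory GRing.Theory Num.Theory.
Import numFieldNormedType.Exports.

Local Open Scope classical_set_scope.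
Local Open Scope ring_scope.

(** * Convex sets and initial topologies *)

Lemma convex_setP (R : realType) (M : lmodType R) (A : set M) :
  convex_set A <-> forall x y (t : R), 0 <= t <= 1 -> A x -> A y ->
    A (t *: x + (1 - t) *: y).
Proof.
split=> [cA x y t t01 Ax Ay|cA x y l].
  pose l := Itv01 (andP t01).1 (andP t01).2.
  by have := cA x y l (mem_set Ax) (mem_set Ay); rewrite inE.
rewrite !inE => Ax Ay; apply: cA => //.
by apply/andP; split; [exact: ge0|exact: le1].
Qed.

Lemma scaler_convB (R : realType) (M : lmodType R) (t : R) (a b x : M) :
  t *: a + (1 - t) *: b - x = t *: (a - x) + (1 - t) *: (b - x).
Proof.
by rewrite !scalerBr addrACA -opprD -scalerDl [t + _]addrC subrK scale1r.
Qed.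

Lemma setI_eqP (T : Type) (A B C : set T) :
  A `&` C = B `&` C <-> forall y, C y -> A y <-> B y.
Proof.
split=> [/seteqP[AB BA] y Cy|AB].
  split=> [Ay|By].
    by have [] := AB y (conj Ay Cy).
  by have [] := BA y (conj By Cy).
by apply/seteqP; split=> y [h Cy]; split=> //; apply/(AB y Cy).
Qed.

Lemma nbhs_initial (S : choiceType) (T : topologicalType) (f : S -> T)
    (x : initial_topology f) (A : set (initial_topology f)) :
  nbhs x A <-> exists2 U, nbhs (f x) U & f @^-1` U `<=` A.
Proof.
split=> [[_ [[U oU <-] Ux UA]]|[U]].
  by exists U => //; exact: open_nbhs_nbhs.
rewrite nbhsE => -[V [oV Vx] VU] UA; exists (f @^-1` V); split=> //.
  by exists V.
by apply: subset_trans UA; exact: preimage_subset.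
Qed.

(** * A subspace as a locally convex space *)

Section linsub_tvs.
Context {R : realType} {X : tvsType R} (W : submodClosed X).
Local Notation inc := (\val : linsub W -> X).

Lemma nbhs_linsub (x : linsub W) (A : set (linsub W)) :
  nbhs x A <-> exists2 U, nbhs (inc x) U & inc @^-1` U `<=` A.
Proof. exact: nbhs_initial. Qed.

Lemma cvg_linsub (T : Type) (F : set_system T) {FF : Filter F}
    (f : T -> linsub W) (x : linsub W) :
  f @ F --> x <-> inc (f t) @[t --> F] --> inc x.
Proof.
split=> [fx U Ux|fx A /nbhs_linsub [U Ux UA]].
  have /fx : nbhs x (inc @^-1` U) by apply/nbhs_linsub; exists U.
  exact.
have := fx U Ux; rewrite !nbhs_filterE /fmap /=; apply: filterS => t; exact: UA.
Qed.

Let linsub_add_continuous :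
  continuous (fun z : linsub W * linsub W => z.1 + z.2).
Proof.
move=> [x y]; rewrite /continuous_at; apply/cvg_linsub.
apply: (@cvg_comp _ _ _ (fun z : linsub W * linsub W => (inc z.1, inc z.2))
  (fun z => z.1 + z.2) _ (nbhs (inc x, inc y))); last first.
  exact: (add_continuous (inc x, inc y)).
by apply: cvg_pair => /=; apply/cvg_linsub; [exact: cvg_fst|exact: cvg_snd].
Qed.

Let linsub_scale_continuous :
  continuous (fun z : R^o * linsub W => z.1 *: z.2).
Proof.
move=> [a y]; rewrite /continuous_at; apply/cvg_linsub.
apply: (@cvg_comp _ _ _ (fun z : R^o * linsub W => (z.1, inc z.2))
  (fun z => z.1 *: z.2) _ (nbhs (a, inc y))); last first.
  exact: (scale_continuous (a, inc y)).
apply: (@cvg_pair _ _ _ _ (nbhs (a : R^o)) (nbhs (inc y))) => /=.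
  exact: cvg_fst.
by apply/cvg_linsub; exact: cvg_snd.
Qed.

Let linsub_locally_convex : exists2 B : set_system (linsub W),
  (forall b, b \in B -> convex_set b) & basis B.
Proof.
have [B Bc [Bo Bx]] := @locally_convex R X.
exists [set inc @^-1` b | b in B].
  move=> A /set_mem [b Bb <-]; apply/convex_setP => x y t t01 /= bx by_.
  have /convex_setP := Bc b (mem_set Bb); exact.
split=> [_ [b Bb <-]|x A /nbhs_linsub [U Ux UA]].
  by exists b => //; exact: Bo.
have [b [Bb bx] bU] := Bx _ U Ux.
exists (inc @^-1` b); first by split=> //; exists b.
by apply: subset_trans UA; exact: preimage_subset.
Qed.

HB.instance Definition _ :=
  Uniform.copy (linsub W) (@initial_topology (linsub W) X inc).
HB.instance Definition _ :=
  PreTopologicalNmodule_isTopologicalNmodule.Build (linsub W)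
    linsub_add_continuous.
HB.instance Definition _ :=
  TopologicalNmodule_isTopologicalLmodule.Build R (linsub W)
    linsub_scale_continuous.
HB.instance Definition _ :=
  Uniform_isTvs.Build R (linsub W) linsub_locally_convex.

End linsub_tvs.

(** * Seminorms and their balls *)

Section seminorm_theory.
Context {R : realType} {Y : lmodType R} {p : Y -> R}.
Hypothesis sp : seminorm p.

Lemma seminormD x y : p (x + y) <= p x + p y. Proof. exact: sp.1. Qed.

Lemma seminormZ a x : p (a *: x) = `|a| * p x. Proof. exact: sp.2. Qed.

Lemma seminorm0 : p 0 = 0.
Proof. by rewrite -(scale0r 0) seminormZ normr0 mul0r. Qed.

Lemma seminormN x : p (- x) = p x.
Proof. by rewrite -scaleN1r seminormZ normrN1 mul1r. Qed.

Lemma seminorm_ge0 x : 0 <= p x.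
Proof.
have := seminormD x (- x); rewrite subrr seminorm0 seminormN; lra.
Qed.

Lemma seminorm_dist x y : `|p x - p y| <= p (y - x).
Proof.
have := seminormD (x - y) y; have := seminormD (y - x) x.
rewrite !subrK -(seminormN (x - y)) opprB ler_norml; lra.
Qed.

Lemma convex_set_seminorm_lt r x : convex_set [set y | p (y - x) < r].
Proof.
apply/convex_setP => a b t /andP[t0 t1] /= pa pb.
rewrite scaler_convB; apply: le_lt_trans (seminormD _ _) _.
rewrite !seminormZ !ger0_norm; try lra.
(* Comparing with the larger value keeps the inequality strict also at [t = 0] and [t = 1]. *)
apply: (@le_lt_trans _ _ (Num.max (p (a - x)) (p (b - x)))); last first.
  by rewrite gt_max pa.
have : p (a - x) <= Num.max (p (a - x)) (p (b - x)) by rewrite le_max lexx.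
have : p (b - x) <= Num.max (p (a - x)) (p (b - x)) by rewrite le_max lexx orbT.
nra.
Qed.

Lemma convex_set_seminorm_le r : convex_set [set y | p y <= r].
Proof.
apply/convex_setP => a b t /andP[t0 t1] /= pa pb.
apply: le_trans (seminormD _ _) _; rewrite !seminormZ !ger0_norm; [nra|lra..].
Qed.

Lemma balanced_seminorm_le r : balanced [set y | p y <= r].
Proof.
move=> a x a1 /= px; rewrite seminormZ; apply: le_trans px.
by rewrite ler_piMl // seminorm_ge0.
Qed.

Lemma absorbs_seminorm_le e r A : 0 < e -> (forall x, A x -> p x <= r) ->
  absorbs [set y | p y <= e] A.
Proof.
(* The [1] keeps [t] away from zero; [r / e] brings [t^-1 *: x] into the ball of radius [e]. *)
move=> e0 Ar; exists (Num.max 1 (r / e)); first by rewrite lt_max ltr01.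
move=> t; rewrite ge_max => /andP[t1]; rewrite ler_pdivrMr // => rt x Ax.
have t0 : t != 0 by rewrite -normr_gt0; lra.
exists (t^-1 *: x); last by rewrite scalerA divff // scale1r.
rewrite /= seminormZ normfV ler_pdivrMl ?normr_gt0 //.
exact: le_trans (Ar _ Ax) rt.
Qed.

End seminorm_theory.

Lemma seminorm_continuous {R : realType} (T : preTopologicalLmodType R)
    (p : T -> R) : seminorm p ->
  (forall x e, 0 < e -> nbhs x [set y | p (y - x) < e]) -> continuous p.
Proof.
move=> sp nbh x; apply/cvgrPdist_lt => e e0.
apply: filterS (nbh x e e0) => y /=; apply: le_lt_trans.
exact: seminorm_dist.
Qed.

Lemma continuous_seminorm_nbhs0 {R : realType} (T : preTopologicalLmodType R)
    (p : T -> R) : seminorm p -> continuous p ->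
  forall e, 0 < e -> nbhs 0 [set y | p y < e].
Proof.
move=> sp cp e e0; have /cvgrPdist_lt/(_ e e0) := cp 0.
apply: filterS => y /=; rewrite (seminorm0 sp) sub0r normrN.
by rewrite ger0_norm // seminorm_ge0.
Qed.

(** * Limits and translations in locally convex spaces *)

Section tvs_theory.
Context {R : realType} {Y : tvsType R}.

Lemma tvs_cvgD {T : Type} {F : set_system T} {FF : Filter F}
    (f g : T -> Y) a b :
  f @ F --> a -> g @ F --> b -> f t + g t @[t --> F] --> a + b.
Proof.
move=> fa gb; apply: (@cvg_comp _ _ _ (fun t => (f t, g t))
  (fun z : Y * Y => z.1 + z.2) _ (nbhs (a, b))).
  exact: cvg_pair fa gb.
exact: (add_continuous (a, b)).
Qed.

Lemma tvs_cvgZ {T : Type} {F : set_system T} {FF : Filter F}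
    (f : T -> R) (g : T -> Y) (a : R) b :
  f @ F --> a -> g @ F --> b -> f t *: g t @[t --> F] --> a *: b.
Proof.
move=> fa gb; apply: (@cvg_comp _ _ _ (fun t => (f t, g t))
  (fun z : R^o * Y => z.1 *: z.2) _ (nbhs ((a : R^o), b))).
  exact: cvg_pair fa gb.
exact: (scale_continuous ((a : R^o), b)).
Qed.

Lemma tvs_cvgZr {T : Type} {F : set_system T} {FF : Filter F}
    (a : R) (g : T -> Y) b :
  g @ F --> b -> a *: g t @[t --> F] --> a *: b.
Proof. by move=> gb; apply: tvs_cvgZ => //; exact: cvg_cst. Qed.

Lemma tvs_cvgZr0 {T : Type} {F : set_system T} {FF : Filter F}
    (a : R) (g : T -> Y) :
  g @ F --> 0 -> a *: g t @[t --> F] --> 0.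
Proof. by move=> /(@tvs_cvgZr _ _ _ a); rewrite scaler0. Qed.

Lemma nbhs_shift (x c : Y) (U : set Y) : nbhs (x + c) U ->
  nbhs x [set y | U (y + c)].
Proof. by apply: (tvs_cvgD (f := id) (g := cst c) cvg_id (cvg_cst _)). Qed.

Lemma nbhs_convex (x : Y) (U : set Y) : nbhs x U ->
  exists V : set Y, [/\ convex_set V, open V, V x & V `<=` U].
Proof.
move=> xU; have [S Sc [So Sx]] := @locally_convex R Y.
have [V [SV Vx] VU] := Sx x U xU.
by exists V; split=> //; [apply: Sc; exact/mem_set|exact: So].
Qed.

Lemma open_shift (c : Y) (U : set Y) : open U -> open [set y | U (y + c)].
Proof.
rewrite !openE => oU x /= /oU; exact: nbhs_shift.
Qed.

Lemma open_opp (U : set Y) : open U -> open [set y | U (- y)].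
Proof.
rewrite !openE => oU x /= /oU Ux.
have : nbhs x [set y | U (-1 *: y)].
  by apply: (tvs_cvgZr (g := id) cvg_id); rewrite scaleN1r.
by apply: filterS => y /=; rewrite scaleN1r.
Qed.

End tvs_theory.

(** * Localization along the balls of a seminorm *)

Section localization_by_seminorm.
Context {R : realType} {Y : tvsType R} (p : Y -> R) (F : set (set Y)).
Hypotheses (hY : hausdorff_space Y) (sp : seminorm p).
Hypothesis p_lsc : forall r, closed [set y | p y <= r].
Hypothesis F_bounded : forall D, F D -> exists r, D `<=` [set y | p y <= r].
Hypothesis F_cofinal : forall r, exists2 D, F D & [set y | p y <= r] `<=` D.
(** First countability of the balls, phrased with neighbourhoods in [Y]: any choice of points of the
    ball in the successive [G n] converges to [x]. *)
Hypothesis ball_countable : forall x r, p x <= r ->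
  exists2 G : nat -> set Y, (forall n, nbhs x (G n)) &
    forall U, nbhs x U ->
      exists n, forall m, (n <= m)%N -> G m `&` [set y | p y <= r] `<=` U.

Local Notation L := (localization F).
Local Notation B r := [set y | p y <= r].

Let ball_open (V : set Y) :=
  forall r, exists2 O : set Y, open O & V `&` B r = O `&` B r.

(** Members of [F] lie in balls and balls lie in members of [F], so relative openness may be tested
    on either. The same [V] serves at all of its points, hence is itself open. *)
Lemma nbhs_locP (x : L) N : nbhs x N <->
  exists V : set Y, [/\ convex_set V, V x, V `<=` N & ball_open V].
Proof.
rewrite nbhsE; split=> [[A [oA Ax] AN]|[V [cV Vx VN oV]]].
  have [V [cV Vx VA oV]] := oA x Ax.
  exists V; split=> // [|r]; first exact: subset_trans AN.
  have [D FD rD] := F_cofinal r; have [O oO OD] := oV D FD; exists O => //.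
  by rewrite -(setIidr rD) !setIA OD.
have oLV : loc_open F V.
  move=> y Vy; exists V; split=> // D FD.
  have [r Dr] := F_bounded FD; have [O oO OD] := oV r; exists O => //.
  by rewrite -(setIidr Dr) !setIA OD.
by exists V.
Qed.

(** The localization is finer: an open convex set is its own trace witness on every ball. *)
Lemma nbhs_locW (x : Y) N : nbhs x N -> nbhs (x : L) N.
Proof.
move=> /nbhs_convex [V [cV oV Vx VN]]; apply/nbhs_locP; exists V; split=> // r.
by exists V.
Qed.

Lemma open_loc (A : set Y) : open A -> open (A : set L).
Proof. rewrite !openE => oA x /oA; exact: nbhs_locW. Qed.

Lemma cvg_locW (T : Type) (G : set_system T) (u : T -> Y) (x : Y) :
  (u : T -> L) @ G --> (x : L) -> u @ G --> x.
Proof. by move=> ux U /nbhs_locW /ux. Qed.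

Lemma nbhs_loc_ball (x : L) N r : nbhs x N -> p x <= r ->
  exists2 U, nbhs (x : Y) U & U `&` B r `<=` N.
Proof.
move=> /nbhs_locP [V [_ Vx VN /(_ r) [O oO OV]]] pxr.
exists O; last by rewrite -OV => y [/VN].
apply: open_nbhs_nbhs; split=> //.
suff : (O `&` B r) x by case.
by rewrite -OV.
Qed.

(** Lower semicontinuity keeps the limit in the ball, where the two topologies agree. *)
Lemma cvg_loc (u : nat -> Y) (x : Y) r : (forall n, p (u n) <= r) ->
  u @ \oo --> x -> (u : nat -> L) @ \oo --> (x : L).
Proof.
move=> ur ux N xN.
have pxr : p x <= r.
  by apply: (closed_cvg _ (@p_lsc r) _ _ ux); exact: nearW.
have [U xU UN] := nbhs_loc_ball xN pxr.
have [n _ nU] := ux U xU.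
by exists n => // m nm; apply: UN; split; [exact: nU|exact: ur].
Qed.

Lemma ball_seq (x : Y) r (P : nat -> set Y) : p x <= r ->
  (forall n U, nbhs x U -> exists y, [/\ U y, p y <= r & P n y]) ->
  exists2 u : nat -> Y, u @ \oo --> x & forall n, p (u n) <= r /\ P n (u n).
Proof.
move=> pxr xP; have [G xG GU] := ball_countable pxr.
have /choice[u uP] : forall n, exists y, [/\ G n y, p y <= r & P n y].
  by move=> n; apply: xP.
exists u => [U /GU[n nU]|n]; last by case: (uP n).
by exists n => // m nm; apply: (nU m nm); case: (uP m).
Qed.

(** A point of [V] in the ball around which no trace fits into [V] would be, by [ball_seq], the
    limit of a sequence in the ball outside [V]. *)
Lemma ball_open_seq (V : set Y) r :
  (forall (u : nat -> Y) x, V x -> p x <= r -> (forall n, p (u n) <= r) ->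
    u @ \oo --> x -> exists n, V (u n)) ->
  exists2 O : set Y, open O & V `&` B r = O `&` B r.
Proof.
move=> Vseq; pose S := [set O : set Y | open O /\ O `&` B r `<=` V].
exists (\bigcup_(O in S) O); first by apply: bigcup_open => O [].
apply/seteqP; split=> x [Vx pxr]; split=> //; last first.
  by case: Vx => O [_ OV] Ox; apply: OV.
have [U xU UV] : exists2 U, nbhs x U & U `&` B r `<=` V.
  apply: contrapT => nU.
  have [|u ux uP] := @ball_seq x r (fun=> ~` V) pxr.
    move=> _ U xU; apply: contrapT => nV; apply: nU; exists U => // y [Uy pyr].
    by apply: contrapT => nVy; apply: nV; exists y.
  have [n] := Vseq u x Vx pxr (fun n => (uP n).1) ux; exact: (uP n).2.
move: xU; rewrite nbhsE => -[O [oO Ox] OU]; exists O => //; split=> //.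
by move=> y [Oy yr]; apply: UV; split=> //; exact: OU.
Qed.

Lemma nbhs_loc_shift (x : L) N : nbhs (0 : L) N -> nbhs x [set y | N (y - x)].
Proof.
move=> /nbhs_locP [V [/convex_setP cV V0 VN oV]]; apply/nbhs_locP.
exists [set y | V (y - x)]; split.
- apply/convex_setP => a b t t01 /= Va Vb.
  by rewrite scaler_convB; exact: cV.
- by rewrite /= subrr.
- by move=> y /VN.
(* Translation by [- x] maps the ball of radius [r] into that of radius [r + p x]. *)
move=> r; have [O oO /setI_eqP OV] := oV (r + p x).
exists [set y | O (y - x)]; first exact: open_shift.
apply/setI_eqP => y /= yr; apply: OV.
by have := seminormD sp y (- x); rewrite /= (seminormN sp); lra.
Qed.

Lemma loc_seminorm_continuous :
  (forall e, 0 < e -> nbhs (0 : L) [set y | p y < e]) ->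
  continuous (p : L -> R).
Proof.
move=> p0; apply: (@seminorm_continuous R L) => // x e e0.
exact: (nbhs_loc_shift x (p0 e e0)).
Qed.

(** * Bounded sets of the localization *)

Lemma nbhs_loc0_disked (N : set L) : nbhs (0 : L) N ->
  exists A : set Y, [/\ A `<=` N, nbhs (0 : L) A, balanced A &
    forall x, exists2 r : R, 0 < r & forall t : R, r <= `|t| -> A (t^-1 *: x)].
Proof.
move=> /nbhs_locP [V [/convex_setP cV V0 VN oV]].
have Vscale (a : R) x : 0 <= a <= 1 -> V x -> V (a *: x).
  by move=> a01 Vx; have := cV x 0 a a01 Vx V0; rewrite scaler0 addr0.
(* The symmetric part of a convex set containing 0 is balanced. *)
exists [set x | V x /\ V (- x)]; split.
- by move=> x [/VN].
- apply/nbhs_locP; exists [set x | V x /\ V (- x)]; split=> //.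
  + apply/convex_setP => a b t t01 /= [Va VNa] [Vb VNb]; split; first exact: cV.
    by rewrite opprD -!scalerN; exact: cV.
  + by rewrite /= oppr0.
  + move=> r; have [O oO /setI_eqP OV] := oV r.
    exists (O `&` [set y | O (- y)]).
      by apply: openI => //; exact: open_opp.
    apply/setI_eqP => y yr; rewrite /= OV // OV //=.
    by rewrite (seminormN sp).
- move=> a x a1 [Vx VNx]; have [a0|a0] := leP 0 a.
    rewrite ger0_norm // in a1.
    by split; rewrite -?scalerN; apply: Vscale => //; lra.
  rewrite ltr0_norm // in a1; split; last first.
    by rewrite -scaleNr; apply: Vscale => //; lra.
  by rewrite -[a]opprK scaleNr -scalerN; apply: Vscale => //; lra.
(* The multiples [a *: x] with [|a| <= 1] stay in the ball of radius [p x], where [V] is the trace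
   of [O]; absorption then follows from continuity of scaling in [Y]. *)
move=> x; have [O oO /setI_eqP E] := oV (p x).
have O0 : nbhs ((0 : R) *: x) O.
  rewrite scale0r; apply: open_nbhs_nbhs; split=> //; apply/E => //.
  by rewrite /= (seminorm0 sp) seminorm_ge0.
have : nbhs (0 : R) [set a | O (a *: x)].
  exact: (tvs_cvgZ (f := id) (g := cst x) cvg_id (cvg_cst _) O0).
move=> /nbhs_ballP[d /= d0 dO].
(* The [1] keeps [t^-1 *: x] in that ball, and [2 / d] makes [|t|^-1] strictly less than [d]. *)
exists (Num.max 1 (2 / d)); first by rewrite lt_max ltr01.
move=> t; rewrite ge_max => /andP[t1 td].
have t0 : 0 < `|t| by lra.
have V1 a : `|a| = `|t|^-1 -> V (a *: x).
  move=> at_; apply/E.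
    by rewrite /= (seminormZ sp) at_ ler_piMl ?seminorm_ge0 // invf_le1.
  apply: dO; rewrite /ball /= sub0r normrN at_.
  rewrite ler_pdivrMr // in td.
  rewrite invf_plt ?posrE //; rewrite -div1r ltr_pdivrMr //; lra.
split; first by apply: V1; rewrite normfV.
by rewrite -scaleNr; apply: V1; rewrite normrN normfV.
Qed.

(** A tail lies in the balanced neighbourhood [A]; the finitely many remaining terms are absorbed
    one by one. *)
Lemma vbounded_cvg0 (u : nat -> L) : u @ \oo --> (0 : L) -> vbounded (range u).
Proof.
move=> u0 U /nbhs_loc0_disked [A [AU A0 bA aA]].
have [N _ NA] := u0 A A0.
have [r r0 rA] : exists2 r : R, 0 < r &
    forall n, (n < N)%N -> forall t : R, r <= `|t| -> A (t^-1 *: u n).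
  elim: N {NA} => [|N [r r0 IH]]; first by exists 1.
  have [s s0 sA] := aA (u N); exists (Num.max r s); first by rewrite lt_max r0.
  move=> n; rewrite ltnS leq_eqVlt => /orP[/eqP -> t|nN t];
    rewrite ge_max => /andP[rt st]; [exact: sA|exact: IH].
exists (Num.max 1 r); first by rewrite lt_max ltr01.
move=> t; rewrite ge_max => /andP[t1 rt] _ [n _ <-].
have t0 : t != 0 by rewrite -normr_gt0; lra.
exists (t^-1 *: u n); last by rewrite scalerA divff // scale1r.
apply: AU; have [/rA|Nn] := ltnP n N; first exact.
apply: bA; last exact: NA.
by rewrite normfV invf_le1 // normr_gt0.
Qed.

(** [V] is [B r + U], where lower semicontinuity gives a convex open [U] around 0 with
    [r < p (u - z)] on [U]. If [z = b + u] with [b] in the ball, then [u - z = - b] has seminorm at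
    most [r], a contradiction. *)
Lemma separate_ball (z : Y) (r : R) : r < p z -> 
  exists V : set Y, [/\ convex_set V, open V, B r `<=` V & ~ V z].
Proof.
move=> rz.
have oP : open [set y | r < p y].
  have -> : [set y | r < p y] = ~` B r.
    by apply/seteqP; split=> y /=; rewrite ltNge => /negP.
  by apply: closed_openC.
have /nbhs_shift/nbhs_convex[U [cU oU U0 UP]] :
    nbhs ((0 : Y) + - z) [set y | r < p y].
  by apply: open_nbhs_nbhs; split=> //=; rewrite sub0r (seminormN sp).
exists (\bigcup_(b in B r) [set y | U (y - b)]); split.
- apply/convex_setP => y1 y2 t t01 [b1 pb1 Ub1] [b2 pb2 Ub2].
  exists (t *: b1 + (1 - t) *: b2).
    by have /convex_setP := convex_set_seminorm_le sp (r := r); exact.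
  have /convex_setP/(_ _ _ t t01 Ub1 Ub2) := cU.
  by rewrite /= !scalerBr addrACA -opprD.
- by apply: bigcup_open => b _; exact: open_shift.
- by move=> b pb; exists b => //=; rewrite subrr.
by move=> [b /= pb /UP /=]; rewrite addrAC subrr add0r (seminormN sp) ltNge pb.
Qed.

Lemma vbounded_loc_seminorm (S : set L) : vbounded S ->
  exists r, forall x, S x -> p x <= r.
Proof.
move=> bS; apply: contrapT => nS.
(* The factor [n.+1] survives the later scaling by [n.+1%:R^-1], which still leaves [y n] outside
   the ball of radius [n]. *)
have /choice[y yP] : forall n : nat, exists y, S y /\ n.+1%:R * n%:R < p y.
  move=> n; apply: contrapT => ny; apply: nS; exists (n.+1%:R * n%:R) => x Sx.
  by rewrite leNgt; apply/negP => h; apply: ny; exists x.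
have /choice[V VP] : forall n, exists V : set Y,
    [/\ convex_set V, open V, B n%:R `<=` V & ~ V (n.+1%:R^-1 *: y n)].
  move=> n; apply: separate_ball.
  rewrite (seminormZ sp) normfV ger0_norm // ltr_pdivlMl ?ltr0n //.
  exact: (yP n).2.
have V0 : nbhs (0 : L) (\bigcap_n V n).
  apply/nbhs_locP; exists (\bigcap_n V n); split=> //.
  - apply/convex_setP => a b t t01 Va Vb n _.
    have [/convex_setP cV _ _ _] := VP n.
    by apply: cV => //; [exact: Va|exact: Vb].
  - by move=> n _; have [_ _ + _] := VP n; apply; rewrite /= (seminorm0 sp).
  (* From [N] on, [V n] contains the whole ball of radius [r], so on this ball the intersection is a
     finite one. *)
  - move=> r; pose N := (Num.truncn `|r|).+1.
    have rN : r <= N%:R.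
      by apply: le_trans (ler_norm r) _; apply: ltW; exact: truncnS_gt.
    exists (\bigcap_(n in `I_N) V n).
      rewrite bigcap_mkord; apply: big_ind => //; [exact: openT|exact: openI|].
      by move=> i _; have [] := VP i.
    apply/seteqP; split=> x [Vx xr]; split=> // n; first by move=> _; exact: Vx.
    move=> _; have [/Vx //|Nn] := ltnP n N; have [_ _ + _] := VP n; apply.
    by apply: le_trans xr (le_trans rN _); rewrite ler_nat.
have [r r0 rS] := bS _ V0.
pose n := Num.truncn r.
have /rS /(_ _ (yP n).1) [v Vv vy] : r <= `|n.+1%:R : R|.
  by rewrite ger0_norm // ltW // truncnS_gt.
have [_ _ _] := VP n; apply; rewrite -vy scalerA mulVf ?scale1r //.
exact: Vv.
Qed.

(** * Continuity of the seminorm and properties of the localization *)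

Lemma seq_continuous_loc :
  sequential_continuous Y R p -> sequential_continuous L R p.
Proof. by move=> cp u x /cvg_locW; exact: cp. Qed.

(** The set [p < e] is convex, so only its traces on balls have to be open. There sequences decide,
    and convergent sequences in a ball also converge for the localization. *)
Lemma seq_continuous_loc_continuous :
  sequential_continuous L R p -> continuous (p : L -> R).
Proof.
move=> cp; apply: loc_seminorm_continuous => e e0.
apply/nbhs_locP; exists [set y | p y < e]; split=> //.
- have := convex_set_seminorm_lt sp (r := e) (x := 0).
  by under eq_set do rewrite subr0.
- by rewrite /= (seminorm0 sp).
move=> r; apply: ball_open_seq => u x /= pxe pxr pu ux.
have /cvgrPdist_lt/(_ (e - p x)) := cp u x (cvg_loc pu ux).
rewrite subr_gt0 => /(_ pxe) [n _ /(_ n (leqnn n))] /=.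
by rewrite ltr_norml => pn; exists n => /=; lra.
Qed.

(** By continuity, [x] stays in the closure of the part of [A] in the ball of radius [p x + 1],
    where first countability yields a sequence. *)
Lemma loc_continuous_frechet_urysohn :
  continuous (p : L -> R) -> frechet_urysohn L.
Proof.
move=> cp A x clA.
have [|u ux uP] := @ball_seq x (p x + 1) (fun=> A) ltac:(lra).
  move=> _ U xU.
  have /cvgrPdist_lt/(_ 1 ltr01) px1 := cp x.
  have [y [Ay [Uy /= pxy]]] := clA _ (filterI (nbhs_locW xU) px1).
  exists y; split=> //; move: pxy; rewrite ltr_norml; lra.
exists u => [n|]; first exact: (uP n).2.
exact: cvg_loc (fun n => (uP n).1) ux.
Qed.

(** If [A] is no neighbourhood of 0, some null sequence [z] in the unit ball has every [z n / n.+1]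
    outside [A]; but [z] is bounded, hence absorbed by [A]. *)
Lemma loc_continuous_bornological :
  continuous (p : L -> R) -> bornological L.
Proof.
move=> cp A cA bA abA; apply: contrapT => nA.
have [||z z0 zP] := @ball_seq (0 : Y) 1
  (fun n => [set y | ~ A (n.+1%:R^-1 *: y)]).
- by rewrite (seminorm0 sp).
- move=> n U U0.
  have nbp := continuous_seminorm_nbhs0 (T := L) sp cp (e := n.+1%:R^-1).
  rewrite invr_gt0 ltr0n in nbp.
  have nbU : nbhs (0 : Y) [set y | U (n.+1%:R *: y)].
    by apply: (tvs_cvgZr (g := id) cvg_id); rewrite scaler0.
  apply: contrapT => nU; apply: nA.
  apply: filterS (filterI (nbp isT) (nbhs_locW nbU)) => x [/= px Ux].
  apply: contrapT => nAx; apply: nU; exists (n.+1%:R *: x); split=> //.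
    rewrite (seminormZ sp) ger0_norm // -ler_pdivlMl ?ltr0n // mulr1.
    exact: ltW.
  by rewrite /= scalerA mulVf ?scale1r.
have zb : vbounded (range (z : nat -> L)).
  exact: vbounded_cvg0 (cvg_loc (fun n => (zP n).1) z0).
have [r r0 rA] := abA _ zb.
pose n := Num.truncn r.
have rn : r <= `|n.+1%:R : R| by rewrite ger0_norm // ltW // truncnS_gt.
have [a Aa az] := rA _ rn (z n) (ex_intro2 _ _ n I erefl).
by apply: (zP n).2; rewrite /= -az scalerA mulVf ?scale1r.
Qed.

Lemma bornological_loc_continuous :
  bornological L -> continuous (p : L -> R).
Proof.
move=> bL; apply: loc_seminorm_continuous => e e0.
have e20 : 0 < e / 2 by lra.
have : nbhs (0 : L) (B (e / 2)).
  apply: bL => [||S /vbounded_loc_seminorm [r Sr]].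
  - exact: convex_set_seminorm_le.
  - exact: balanced_seminorm_le.
  - exact: absorbs_seminorm_le Sr.
by apply: filterS => y /=; lra.
Qed.

Lemma loc_continuous_seq_continuous :
  continuous (p : L -> R) -> sequential_continuous Y R p.
Proof.
move=> cp u x ux; apply/cvgrPdist_lt => e e0.
have v0 : u n - x @[n --> \oo] --> (0 : Y).
  by rewrite -(subrr x); apply: tvs_cvgD => //; exact: cvg_cst.
(* Normalised so that [p (w n) = min 1 (p (u n - x))] stays bounded. *)
pose w n := (Num.max 1 (p (u n - x)))^-1 *: (u n - x).
have M0 n : 0 < Num.max 1 (p (u n - x)) by rewrite lt_max ltr01.
have pw n : p (w n) = (Num.max 1 (p (u n - x)))^-1 * p (u n - x).
  by rewrite (seminormZ sp) normfV ger0_norm // ltW.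
have w0 : w n @[n --> \oo] --> (0 : Y).
  (* [w n] lies on the segment from 0 to [u n - x], so convex neighbourhoods of 0 retain it. *)
  move=> U /nbhs_convex[V [/convex_setP cV oV V0 VU]].
  have V0n : nbhs (0 : Y) V by apply: open_nbhs_nbhs.
  have [N _ NV] := v0 V V0n; exists N => // n /NV /= Vn; apply: VU.
  have := cV (u n - x) 0 (Num.max 1 (p (u n - x)))^-1 _ Vn V0.
  rewrite scaler0 addr0; apply.
  by rewrite invr_ge0 ltW //= invf_le1 // le_max lexx.
have /cvg_loc/(_ w0) wL : forall n, p (w n) <= 1.
  by move=> n; rewrite pw ler_pdivrMl // mulr1 le_max lexx orbT.
(* A value [p (w n) < 1] rules out [p (u n - x) > 1], and then [w n] is [u n - x] itself. *)
have e10 : 0 < Num.min 1 e by rewrite lt_min ltr01.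
have [N _ Np] := wL _ (continuous_seminorm_nbhs0 (T := L) sp cp e10).
exists N => // n /Np /=; rewrite pw lt_min => /andP[pw1 pwe].
rewrite -normrN opprB; apply: le_lt_trans (_ : p (u n - x) < e).
  by rewrite -normrN opprB; exact: seminorm_dist.
move: pw1 pwe; have [p1|p1] := leP (p (u n - x)) 1.
  by rewrite invr1 mul1r.
by rewrite mulVf ?ltxx // gt_eqF //; lra.
Qed.

Lemma frechet_urysohn_sequential (T : topologicalType) :
  frechet_urysohn T -> seq_topology T `<=` opens T.
Proof.
move=> fu A sA; rewrite /opens /= -[A]setCK openC => x clA.
have [u nAu ux] := fu _ _ clA; apply/(_ : ~ A x) => Ax.
by have [N _ /(_ N (leqnn N))] := sA u x Ax ux; exact: nAu.
Qed.

(** Sequential continuity puts a tail of every convergent sequence in a ball, so both topologies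
    have the same convergent sequences. *)
Lemma seq_topology_loc : sequential_continuous Y R p -> frechet_urysohn L ->
  seq_topology Y = opens L.
Proof.
move=> cp fu; apply/seteqP; split=> [A sA|A oA].
  apply: frechet_urysohn_sequential => // u x Ax /cvg_locW; exact: sA.
move=> u x Ax ux.
have [N _ Np] : \forall n \near \oo, p (u n) <= p x + 1.
  have /cvgrPdist_lt/(_ 1 ltr01) := cp u x ux.
  by apply: filterS => n; rewrite ltr_norml; lra.
have vx : u (n + N)%N @[n --> \oo] --> x.
  move=> U /ux [M _ MU]; exists M => // n Mn.
  by apply: MU; exact: leq_trans (leq_addr _ _).
have vL := cvg_loc (fun n => Np (n + N)%N (leq_addl _ _)) vx.
have [M _ MA] := vL A (open_nbhs_nbhs (conj oA Ax)).
exists (M + N)%N => // n Mn.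
by have := MA (n - N)%N; rewrite /= subnK; [apply|]; move: Mn => /=; lia.
Qed.

(** Continuity makes a ball around 0 of radius [p x + 1] a neighbourhood of [x] in [Y], and on balls
    the topologies agree. *)
Lemma continuous_opens_loc : continuous p -> opens Y = opens L.
Proof.
move=> cp; apply/seteqP; split; first exact: open_loc.
move=> A oA; rewrite /opens /= openE => x Ax.
have /cvgrPdist_lt/(_ 1 ltr01) px1 := cp x.
have px : p x <= p x + 1 by lra.
have [U xU UA] := nbhs_loc_ball (open_nbhs_nbhs (conj oA Ax)) px.
apply: filterS (filterI xU px1) => y [Uy /= pxy]; apply: UA; split=> //=.
move: pxy; rewrite ltr_norml; lra.
Qed.

(** By lower semicontinuity the closed balls of [p] are barrels. *)
Lemma barrelled_continuous : barrelled Y -> continuous p.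
Proof.
move=> bY; apply: seminorm_continuous => // x e e0.
have e20 : 0 < e / 2 by lra.
(* Writing 0 as [x - x] lets [nbhs_shift] carry the neighbourhood to [x]. *)
have : nbhs (x - x) (B (e / 2)).
  rewrite subrr; apply: bY => //; [exact: convex_set_seminorm_le|
    exact: balanced_seminorm_le|].
  by move=> y; apply: (absorbs_seminorm_le sp (r := p y)) => // _ ->.
by move=> /nbhs_shift; apply: filterS => y /=; lra.
Qed.

Lemma barrelled_loc_continuous : barrelled L -> continuous (p : L -> R).
Proof.
move=> bL; apply: loc_seminorm_continuous => e e0.
have e20 : 0 < e / 2 by lra.
have : nbhs (0 : L) (B (e / 2)).
  apply: bL; [exact: convex_set_seminorm_le|exact: balanced_seminorm_le| |].
    rewrite -[B _]setCK; apply: open_closedC; apply: open_loc.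
    exact: closed_openC.
  by move=> y; apply: (absorbs_seminorm_le sp (r := p y)) => // _ ->.
by apply: filterS => y /=; lra.
Qed.

Lemma frechet_urysohn_loc_continuous :
  frechet_urysohn L -> continuous (p : L -> R).
Proof.
move=> fu; apply: loc_seminorm_continuous => e e0; apply: contrapT => npe.
have cl0 : closure ([set y | e <= p y] : set L) 0.
  move=> N N0; apply: contrapT => nN; apply: npe; apply: filterS N0 => y Ny /=.
  by rewrite ltNge; apply/negP => ey; apply: nN; exists y.
have [y' yA yL] := fu _ _ cl0; pose y : nat -> Y := y'.
have y0 : y @ \oo --> (0 : Y) := cvg_locW yL.
have [M yM] := vbounded_loc_seminorm (vbounded_cvg0 yL).
pose w := y 0%N.
have w0 : w != 0.
  by apply/eqP => w0; have : e <= p w := yA 0%N; rewrite w0 (seminorm0 sp); lra.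
pose z (m n : nat) : Y := m.+1%:R^-1 *: w + m.+1%:R *: y n.
have zm m : z m n @[n --> \oo] --> m.+1%:R^-1 *: w.
  rewrite -[X in _ --> X]addr0.
  by apply: tvs_cvgD; [exact: cvg_cst|exact: tvs_cvgZr0].
(* Row [m] converges to a nonzero vector, so by separation some neighbourhood of 0 misses the row
   from some index on; [UN m] pairs the two. *)
have /choice[UN UNP] : forall m, exists UN : set Y * nat,
    nbhs (0 : Y) UN.1 /\ forall n, (UN.2 <= n)%N -> ~ UN.1 (z m n).
  move=> m; apply: contrapT => nUN.
  have /eqP : (0 : Y) = m.+1%:R^-1 *: w.
    apply: hY => A D A0 Dw; apply: contrapT => nAD; apply: nUN.
    have [N _ ND] := zm m D Dw; exists (A, N); split=> // n Nn Az; apply: nAD.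
    by exists (z m n); split=> //; exact: ND.
  by rewrite eq_sym scaler_eq0 (negPf w0) orbF invr_eq0 pnatr_eq0.
(* Each row is truncated past [(UN m).2], so that it avoids the neighbourhood
   [(UN m).1] of 0. *)
pose Z : set L := [set x | exists m n, ((UN m).2 <= n)%N /\ x = z m n].
have clZ : closure Z 0.
  move=> N /nbhs_locP[V [cV V0 VN oV]].
  have NV : nbhs (0 : L) V by apply/nbhs_locP; exists V; split.
  (* [z m n] is the midpoint of [2 *: (m.+1%:R^-1 *: w)] and [2 *: (m.+1%:R *: y n)]. Both are null
     sequences in a ball, the second for fixed [m], so convexity of [V] puts a midpoint into [V]. *)
  have wY : 2 *: (m.+1%:R^-1 *: w) @[m --> \oo] --> (0 : Y).
    apply: tvs_cvgZr0; rewrite -(scale0r w).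
    by apply: tvs_cvgZ; [exact: cvg_harmonic|exact: cvg_cst].
  have pw m : p (2 *: (m.+1%:R^-1 *: w)) <= 2 * p w.
    rewrite !(seminormZ sp) ger0_norm // ler_pM2l // normfV ger0_norm //.
    by rewrite ler_piMl ?seminorm_ge0 // invf_le1 ?ltr0n // ler1n.
  have [m _ mV] := cvg_loc pw wY NV.
  have yY : 2 *: (m.+1%:R *: y n) @[n --> \oo] --> (0 : Y).
    by do 2 apply: tvs_cvgZr0.
  have py n : p (2 *: (m.+1%:R *: y n)) <= 2 * (m.+1%:R * M).
    rewrite !(seminormZ sp) !ger0_norm // !ler_pM2l ?ltr0n //.
    by apply: yM; exists n.
  have [n _ nV] := cvg_loc py yY NV.
  exists (z m (maxn n (UN m).2)); split.
    by exists m, (maxn n (UN m).2); split=> //; exact: leq_maxr.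
  apply: VN; move/convex_setP: cV => cV.
  have := cV _ _ 2^-1 _ (mV m (leqnn m)) (nV _ (leq_maxl n (UN m).2)).
  rewrite (_ : 1 - 2^-1 = 2^-1 :> R); last by lra.
  rewrite !scalerA !mulrA mulVf // !mul1r; apply; lra.
have [s sZ sL] := fu Z 0 clZ.
have [K sK] := vbounded_loc_seminorm (vbounded_cvg0 sL).
(* Since [m.+1 * e <= p (m.+1 *: y n) <= K + p w] whenever [z m n] is a term of [s], only rows below
   [k] occur, and finitely many neighbourhoods exclude them all. *)
pose k := (Num.truncn `|(K + p w) / e|).+1.
have U0 : nbhs (0 : Y) (\bigcap_(m in `I_k) (UN m).1).
  rewrite bigcap_mkord; apply: big_ind => [||m _].
  - exact: filterT.
  - exact: filterI.
  - exact: (UNP m).1.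
have [N _ NU] := cvg_locW sL U0.
have [m [n [mn smn]]] := sZ N.
have mk : (m < k)%N.
  have sKN : p (s N) <= K by apply: sK; exists N.
  have := seminormD sp (z m n) (- (m.+1%:R^-1 *: w)).
  rewrite {1}/z addrAC subrr add0r (seminormN sp) !(seminormZ sp) normfV.
  rewrite !ger0_norm // -smn.
  have : m.+1%:R^-1 * p w <= p w.
    by rewrite ler_piMl ?seminorm_ge0 // invf_le1 ?ltr0n // ler1n.
  have : m.+1%:R * e <= m.+1%:R * p (y n).
    by rewrite ler_pM2l ?ltr0n //; exact: yA.
  move=> h1 h2 h3; have : m.+1%:R <= (K + p w) / e.
    by rewrite ler_pdivlMr //; exact: le_trans h1 (le_trans h3 (lerD sKN h2)).
  rewrite -(@ltr_nat R) -natr1 => h4.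
  have := ler_norm ((K + p w) / e); have := truncnS_gt `|(K + p w) / e|.
  rewrite -/k; lra.
have := NU N (leqnn N) m mk; rewrite smn; exact: (UNP m).2.
Qed.

End localization_by_seminorm.

(** * Sequential and first countable spaces *)

Lemma sequentially_open_open (T : topologicalType) :
  opens T `<=` seq_topology T.
Proof. by move=> A oA u x Ax; apply; exact: open_nbhs_nbhs. Qed.

Lemma first_countable_seq (T : topologicalType) : first_countable T ->
  forall x : T, exists2 G : nat -> set T, (forall n, nbhs x (G n)) &
    forall U, nbhs x U -> exists n, forall m, (n <= m)%N -> G m `<=` U.
Proof.
move=> fT x; have [S cS [Sx SU]] := fT x.
have [V0 SV0 _] := SU _ (@filterT _ (nbhs x) _).
have /pfcard_geP[S0|[f]] := cS; first by rewrite S0 in SV0.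
(* Finite intersections make the base decreasing; the bound [n.+1] includes [f n] itself. *)
exists (fun n => \bigcap_(i in `I_n.+1) f i) => [n|U /SU [V SV VU]].
  rewrite bigcap_mkord; apply: big_ind => [||i _].
  - exact: filterT.
  - exact: filterI.
  - by apply: Sx; exact: funS.
have [n _ fn] := @surj _ _ _ _ f _ SV.
by exists n => m nm y /(_ n nm); rewrite fn; exact: VU.
Qed.

(** [O] is [A] together with the complement of [W]. It is sequentially open because [W] is closed: a
    sequence tending to a point off [W] eventually stays off [W]. *)
Lemma sequential_linsub {R : realType} (X : tvsType R) (W : submodClosed X) :
  closed [set` W] -> sequential_space X -> sequential_space (linsub W).
Proof.
move=> cW sX; apply/seteqP; split; first exact: sequentially_open_open.
move=> A sA; pose O := [set x : X | forall y : linsub W, \val y = x -> A y].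
suff : opens X O.
  move=> oO; exists O => //; apply/seteqP; split=> [y|y Ay z]; first exact.
  by move=> /val_inj ->.
rewrite sX => u x Ox ux; have [Wx|nWx] := boolP (x \in W); last first.
  have : nbhs x (~` [set` W]).
    by apply: open_nbhs_nbhs; split; [exact: closed_openC|exact/negP].
  move=> /ux [N _ NW]; exists N => // n /NW /= nW y yn.
  by exfalso; apply: nW; rewrite -yn; exact: valP.
(* Terms outside [W] are replaced by the limit, which preserves convergence. *)
pose y : linsub W := Sub x Wx; pose v n : linsub W := insubd y (u n).
have vy : v @ \oo --> y.
  apply/cvg_linsub => U Ux; have [N _ NU] := ux U Ux.
  exists N => // n /NU /=; rewrite val_insubd; case: ifP => // _ _.
  exact: nbhs_singleton.
have Ay : A y by apply: Ox.
have [N _ NA] := sA v y Ay vy; exists N => // n /NA /= Av z zn.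
by have <- : v n = z by apply: val_inj; rewrite val_insubd -zn (valP z).
Qed.

Lemma opens_barrelled {R : realType} (Y : preTopologicalLmodType R)
    (F : set (set Y)) : opens Y = opens (localization F) ->
  barrelled Y <-> barrelled (localization F).
Proof.
move=> E.
have nE (A : set Y) : nbhs (0 : Y) A <-> nbhs (0 : localization F) A.
  rewrite !nbhsE; split=> -[O [oO O0] OA]; exists O => //; split=> //.
    by have : opens Y O by []; rewrite E.
  by have : opens (localization F) O by []; rewrite -E.
have cE (A : set Y) : closed A <-> closed (A : set (localization F)).
  rewrite -!openC; split=> oA.
    by have : opens Y (~` A) by []; rewrite E.
  by have : opens (localization F) (~` A) by []; rewrite -E.
by split=> bY A cA bA clA aA; apply/nE; apply: bY => //; apply/cE.
Qed.

(** * The equivalences on a fixed subspace *)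

Theorem theorem3p10 (R : realType) (X : tvsType R) (p : X -> R)
    (X_ : nat -> submodClosed X) (C_ : nat -> set X) :
  hausdorff_space X ->
  seminorm p ->
  lower_semicontinuous (fun x : X => (p x)%:E) ->
  (forall j k, (j <= k)%N -> [set` X_ j] `<=` [set` X_ k]) ->
  (forall k, closed [set` X_ k]) ->
  \bigcup_k [set` X_ k] = [set: X] ->
  (forall k, C_ k = [set` X_ k] `&` [set x | p x <= k%:R]) ->
  (forall k, first_countable (set_type (C_ k))) ->
  let C : set (set X) := range C_ in
  forall k,
  let Xk : preTopologicalLmodType R := linsub (X_ k) in
  let Xk_loc : preTopologicalLmodType R :=
    localization (restrict_family (X_ k) C) in
  let pk : linsub (X_ k) -> R := fun x => p (\val x) in
  let P1 := barrelled Xk in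
  let P2 := barrelled Xk_loc in
  let P3 := continuous (pk : Xk -> R) in
  let P4 := sequential_continuous Xk R pk in
  let P5 := sequential_continuous Xk_loc R pk in
  let P6 := continuous (pk : Xk_loc -> R) in
  let P7 := frechet_urysohn Xk_loc in
  let P8 := bornological Xk_loc in
  let P9 := seq_topology Xk = opens Xk_loc in
  let P10 := opens Xk = opens Xk_loc in
  [/\ [<-> P4; P5; P6; P7; P8],
      P1 \/ P2 \/ P3 -> [/\ P4, P5, P6, P7 & P8],
      P3 -> P10,
      sequential_space (localization C) ->
        P4 \/ P5 \/ P6 \/ P7 \/ P8 -> P9 &
      sequential_space X -> sequential_space (localization C) ->
        [/\ [<-> P3; P4; P5; P6; P7; P8],
            P1 <-> P2,
            P1 \/ P2 -> P3 /\ [/\ P4, P5, P6, P7 & P8] &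
            P3 \/ P4 \/ P5 \/ P6 \/ P7 \/ P8 -> P10]].
Proof.
move=> hX sp /lower_semicontinuousP lsc mono clX _ CE fc C k Xk Xk_loc pk.
move=> P1 P2 P3 P4 P5 P6 P7 P8 P9 P10.
have hY : hausdorff_space (linsub (X_ k)).
  move=> x y cxy; apply: val_inj; apply: hX => A D Ax Dy.
  have Ax' : nbhs x (\val @^-1` A) by apply/nbhs_linsub; exists A.
  have Dy' : nbhs y (\val @^-1` D) by apply/nbhs_linsub; exists D.
  by have [z [Az Dz]] := cxy _ _ Ax' Dy'; exists (\val z).
have spk : seminorm pk.
  by split=> [x y|a x]; [exact: (seminormD sp)|exact: (seminormZ sp)].
have pk_lsc r : closed [set y | pk y <= r].
  rewrite -openC; exists [set x | r%:E < (p x)%:E]%E; first exact: lsc.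
  by apply/seteqP; split=> y /=; rewrite lte_fin ltNge => /negP.
(* With [k <= j] the subspace lies in that of index [j], so its ball of radius [r] lies in
   [C_ j]. *)
have large (r : R) : exists j, (k <= j)%N /\ r <= j%:R.
  exists (maxn k (Num.truncn `|r|).+1); split; first exact: leq_maxl.
  apply: le_trans (ler_norm r) (le_trans (ltW (truncnS_gt _)) _).
  by rewrite ler_nat leq_maxr.
have inC j r (y : linsub (X_ k)) : (k <= j)%N -> r <= j%:R -> pk y <= r ->
    C_ j (\val y).
  move=> kj rj yr; rewrite CE; split; last exact: le_trans yr rj.
  by apply: (mono _ _ kj); exact: (valP y).
have F_bounded D : restrict_family (X_ k) C D ->
    exists r, D `<=` [set y | pk y <= r].
  move=> [_ [j _ <-] <-]; exists j%:R => y /=.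
  by rewrite CE => -[].
have F_cofinal r : exists2 D, restrict_family (X_ k) C D &
    [set y | pk y <= r] `<=` D.
  have [j [kj rj]] := large r; exists (\val @^-1` C_ j) => [|y].
    by exists (C_ j) => //; exists j.
  by exact: inC.
(* The ball sits in some [C_ j], whose countable base at [x] comes from neighbourhoods in [X]; these
   are pulled back to the subspace. *)
have ballc (x : linsub (X_ k)) r : pk x <= r ->
    exists2 G : nat -> set (linsub (X_ k)), (forall n, nbhs x (G n)) &
      forall U, nbhs x U ->
      exists n, forall m, (n <= m)%N -> G m `&` [set y | pk y <= r] `<=` U.
  move=> xr; have [j [kj rj]] := large r.
  pose lift_ y yr : set_type (C_ j) := SigSub (mem_set (inC j r y kj rj yr)).
  have [G Gx GU] := first_countable_seq (fc j) (lift_ x xr).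
  have /choice[O OP] : forall n, exists O : set X,
      nbhs (\val x) O /\ set_val @^-1` O `<=` G n.
    by move=> n; have /nbhs_initial[O Ox OG] := Gx n; exists O.
  exists (fun n => \val @^-1` O n) => [n|U /nbhs_linsub[V Vx VU]].
    by apply/nbhs_linsub; exists (O n) => //; exact: (OP n).1.
  have [|n nV] := GU (set_val @^-1` V); first by apply/nbhs_initial; exists V.
  exists n => m nm y [Oy yr]; apply: VU.
  by apply: (nV m nm (lift_ y yr)); apply: (OP m).2.
have P45 : P4 -> P5 by exact: seq_continuous_loc.
have P56 : P5 -> P6 by exact: seq_continuous_loc_continuous.
have P67 : P6 -> P7 by exact: loc_continuous_frechet_urysohn.
have P76 : P7 -> P6 by exact: frechet_urysohn_loc_continuous.
have P68 : P6 -> P8 by exact: loc_continuous_bornological.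
have P86 : P8 -> P6 by exact: bornological_loc_continuous.
have P64 : P6 -> P4 by exact: loc_continuous_seq_continuous.
have P13 : P1 -> P3 by exact: barrelled_continuous.
have P26 : P2 -> P6 by exact: barrelled_loc_continuous.
have P34 : P3 -> P4 by move=> cp u x ux; apply: cvg_comp ux (cp x).
have P310 : P3 -> P10 by exact: continuous_opens_loc.
have P69 : P6 -> P9.
  by move=> h6; apply: seq_topology_loc; [..|exact: P64|exact: P67].
have to6 : P4 \/ P5 \/ P6 \/ P7 \/ P8 -> P6 by tauto.
split=> //.
- by tfae; tauto.
- move=> h; have h6 : P6 by tauto.
  split; tauto.
- by move=> _ /to6.
move=> sX _; have sY := sequential_linsub (clX k) sX.
(* The closed subspace inherits sequentiality from [X], which turns P9 into P10. *)
have P610 : P6 -> P10 by move=> /P69; rewrite /P10 /opens /= -/(opens _) sY.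
have P63 : P6 -> P3.
  move=> h6; move: (P610 h6) => h10.
  apply/continuousP => A oA; have /continuousP/(_ A oA) := h6.
  by change (opens Xk_loc (pk @^-1` A) -> opens Xk (pk @^-1` A)); rewrite h10.
have P12 : P10 -> (P1 <-> P2) by exact: opens_barrelled.
split.
- by tfae; tauto.
(* Each of P1 and P2 first forces the two topologies to coincide. *)
- by split=> h; [apply/(P12 (P310 (P13 h)))|apply/(P12 (P610 (P26 h)))].
- move=> h; have h6 : P6 by tauto.
  split; [exact: P63|split; tauto].
- by tauto.
Qed.
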